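(* Every graph $G$ with $n\geq 3$ vertices that has no $K_{3,3}$-minor satisfies $c(G)\leq\frac{4}{3}(7n-11)$. Conversely, for every integer $n\geq 5$ with $n\equiv 2\pmod 3$ there exists a graph $G$ with $n$ vertices and no $K_{3,3}$-minor such that $c(G)=\frac{4}{3}(7n-11)$.
   Context: All graphs are finite, simple and undirected. A graph $H$ is a minor of $G$ if $H$ can be obtained from a subgraph of $G$ by contracting edges. A clique of a graph $G$ is a (possibly empty) set of pairwise adjacent vertices; $c(G)$ denotes the number of cliques of $G$ (including the empty clique, all single vertices and all edges). *)

(* Defs.v *)
From mathcomp Require Import all_boot.
Set Implicit Arguments. Unset Strict Implicit. Unset Printing Implicit Defensive.

Definition simple_graph (T : finType) (e : rel T) : Prop :=
  symmetric e /\ irreflexive e.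

Definition connected_in (T : finType) (e : rel T) (A : {set T}) : Prop :=
  forall x y, x \in A -> y \in A ->
    connect [rel u v | [&& e u v, u \in A & v \in A]] x y.

(* (U,f) is a minor of (T,e): there is a minor model, i.e. pairwise disjoint,
   nonempty, connected branch sets B u (u : U), such that every edge uv of
   (U,f) is realised by an edge of (T,e) between B u and B v.  This is the
   standard equivalent form of "obtained from a subgraph by contracting edges". *)
Definition is_minor (U : finType) (f : rel U) (T : finType) (e : rel T) : Prop :=
  exists B : U -> {set T},
    [/\ (forall u, B u != set0),
        (forall u v, u != v -> [disjoint B u & B v]),
        (forall u, connected_in e (B u)) &
        (forall u v, f u v -> exists x y, [/\ x \in B u, y \in B v & e x y])].

Definition K33_rel : rel (bool * 'I_3) := fun x y => x.1 != y.1.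

Definition K33_minor_free (T : finType) (e : rel T) : Prop :=
  ~ is_minor K33_rel e.

Definition is_clique (T : finType) (e : rel T) (A : {set T}) : bool :=
  [forall x in A, forall y in A, (x != y) ==> e x y].

(* c(G) = number of cliques, including the empty clique *)
Definition num_cliques (T : finType) (e : rel T) : nat :=
  #|[set A : {set T} | is_clique e A]|.

(* Main.v *)
Require Import Defs.
From mathcomp Require Import all_boot.
From mathcomp Require Import zify.
Set Implicit Arguments. Unset Strict Implicit. Unset Printing Implicit Defensive.

(**
Induct on the number of vertices. Contracting an edge uv loses at most
2 c(G[N(u) ∩ N(v)]) cliques, which is at most 8 < 28/3 when u and v have at
most two common neighbours. So in a minimal counterexample every edge lies in
three triangles, i.e. the link of every vertex v has minimum degree at least 3.
Take a longest path x_0 x_1 ... in this link, with x_0 x_i an edge, i >= 2 and i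
as small as possible. Both x_0 and x_{i-1}, the first vertex of the rotated path
x_{i-1} ... x_0 x_i ..., have a neighbour beyond x_i on the path, which gives
either a K_{2,3}-minor in the link, hence with v a K33-minor, or a K4 in the
link, hence a K5. If G contains a K5 and a further component C of G - K5, then
either C has three neighbours in the K5, which gives a K33-minor, or G is a
clique-sum over at most two vertices of two smaller graphs, where the bound is
additive. Graphs with at most five vertices satisfy c(G) <= 2^n.
*)

(** * Auxiliary facts on finite sets, disjoint families and permutations *)

Lemma subset_of_card (T : finType) (A B : {set T}) k :
  A \subset B -> #|A| <= k <= #|B| ->
  exists Q : {set T}, [/\ A \subset Q, Q \subset B & #|Q| = k].
Proof.
move=> sAB /andP[]; elim: k => [|k IH] leA leB.
  by exists A; split=> //; apply/eqP; rewrite -leqn0.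
move: leA; rewrite leq_eqVlt => /orP[/eqP <-|ltA]; first by exists A.
have [Q [sAQ sQB cQ]] := IH ltA (ltnW leB).
have /set0Pn[x] : B :\: Q != set0.
  by rewrite -card_gt0 cardsD (setIidPr sQB) cQ subn_gt0.
rewrite inE => /andP[xQ xB]; exists (x |: Q); split.
- exact: subset_trans sAQ (subsetUr _ _).
- by rewrite subUset sub1set xB.
- by rewrite cardsU1 xQ cQ.
Qed.

(** By disjointness, choosing a point of [B u] in [K] for each [u] is injective. This is the
    pigeonhole principle for branch sets. *)
Lemma disjoint_family_card (U T : finType) (B : U -> {set T}) (D : {set U})
    (K : {set T}) :
  (forall u v, u != v -> [disjoint B u & B v]) ->
  (forall u, u \in D -> exists2 x, x \in B u & x \in K) -> #|D| <= #|K|.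
Proof.
move=> disB hit.
have [->|[u0 u0D]] := set_0Vmem D; first by rewrite cards0.
have [x0 _ _] := hit _ u0D.
pose r u := odflt x0 [pick x in B u :&: K].
have rP u : u \in D -> r u \in B u :&: K.
  move=> /hit[x xB xK]; rewrite /r; case: pickP => [y //|/(_ x)].
  by rewrite inE xB xK.
rewrite -(card_in_imset (f := r) (D := D)).
  apply/subset_leq_card/subsetP => y /imsetP[u /rP ru ->].
  by move: ru; rewrite inE => /andP[].
move=> u v /rP; rewrite inE => /andP[ru _] /rP; rewrite inE => /andP[rv _] eq_r.
apply/eqP; case: (boolP (u == v)) => // /disB; rewrite disjoint_subset.
by move=> /subsetP/(_ _ ru); rewrite inE /= eq_r rv.
Qed.

Lemma uniq_flatten_nth (T : eqType) (ss : seq (seq T)) i j x :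
  uniq (flatten ss) -> i != j ->
  x \in nth [::] ss i -> x \in nth [::] ss j -> false.
Proof.
elim: ss i j => [|s ss IH] [|i] [|j] //=; rewrite cat_uniq => /and3P[_ /hasPn dis us].
- move=> _ xs xj; have /dis /negP : x \in flatten ss; last by move=> /(_ xs).
  apply/flattenP; exists (nth [::] ss j) => //; apply: mem_nth.
  by rewrite ltnNge; apply/negP => /(nth_default [::]) eq0; rewrite eq0 in xj.
- move=> _ xj xs; have /dis /negP : x \in flatten ss; last by move=> /(_ xs).
  apply/flattenP; exists (nth [::] ss i) => //; apply: mem_nth.
  by rewrite ltnNge; apply/negP => /(nth_default [::]) eq0; rewrite eq0 in xj.
- by rewrite eqSS; apply: IH.
Qed.

(** Two lists are permutations of each other when every predicate has the same count in both. With
    the boolean counts generalised, this is linear arithmetic. *)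
Ltac perm_count :=
  apply/permP => ?; rewrite /= -?cats1 ?(count_cat, count_rev) /= ?(count_cat, count_rev) /=;
  repeat match goal with |- context [nat_of_bool ?b] => move: (nat_of_bool b) => ? end;
  clear; lia.

(** * Cliques and [K33] models inside a vertex set *)

Section Graphs.

Variable T : finType.
Implicit Types (e : rel T) (S A B C Q : {set T}) (s : seq T).

Definition cliques_in e S : {set {set T}} :=
  [set A : {set T} | (A \subset S) && is_clique e A].

(** Confining the branch sets to [S] lets the induction delete and contract vertices while the type
    [T] stays fixed. *)
Definition K33_in e S : Prop :=
  exists B : bool * 'I_3 -> {set T},
    [/\ (forall u, B u \subset S), (forall u, B u != set0),
        (forall u v, u != v -> [disjoint B u & B v]),
        (forall u, connected_in e (B u)) &
        (forall u v, K33_rel u v -> exists x y, [/\ x \in B u, y \in B v & e x y])].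

Lemma is_cliqueP e A :
  reflect (forall x y, x \in A -> y \in A -> x != y -> e x y) (is_clique e A).
Proof.
apply: (iffP forall_inP) => [h x y xA yA xy|h x xA].
  by have /forall_inP/(_ y yA) := h x xA; rewrite xy.
by apply/forall_inP => y yA; apply/implyP; apply: h.
Qed.

Lemma cliques_inP e S A :
  reflect (A \subset S /\ forall x y, x \in A -> y \in A -> x != y -> e x y)
          (A \in cliques_in e S).
Proof.
by rewrite inE; apply: (iffP andP) => -[? /is_cliqueP].
Qed.

Lemma K33_inS e S1 S2 : S1 \subset S2 -> K33_in e S1 -> K33_in e S2.
Proof.
move=> s12 [B [sB n0 dB cB eB]]; exists B; split=> // u.
exact: subset_trans s12.
Qed.

Lemma connected_in_path e s :
  symmetric e -> sorted e s -> connected_in e [set x in s].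
Proof.
move=> syme; case: s => [|x s] //= p; first by move=> ? ?; rewrite inE.
pose r := [rel u v | [&& e u v, u \in [set y in x :: s] & v \in [set y in x :: s]]].
have symr : symmetric r by move=> u v; rewrite /= syme [(_ \in _) && _]andbC.
have xr y : y \in x :: s -> connect r x y.
  move=> ys; have sub : path r x s.
    apply: (sub_in_path (P := mem (x :: s)) (e := e)) p; last exact/allP.
    by move=> a b aS bS eab; apply/and3P; rewrite !in_set.
  exact: (path_connect sub) ys.
move=> a b; rewrite !in_set => as_ bs_; rewrite -/r.
apply: connect_trans (xr b bs_).
by rewrite (sym_connect_sym symr); apply: xr.
Qed.

Definition adj e (s t : seq T) : Prop := exists x y, [/\ x \in s, y \in t & e x y].

(* Nonemptiness of the branch sets is implied by their adjacencies. *)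
Lemma K33_of_seqs e S (a0 a1 a2 b0 b1 b2 : seq T) :
  symmetric e ->
  uniq (a0 ++ a1 ++ a2 ++ b0 ++ b1 ++ b2) ->
  {subset a0 ++ a1 ++ a2 ++ b0 ++ b1 ++ b2 <= S} ->
  (forall s, s \in [:: a0; a1; a2; b0; b1; b2] -> connected_in e [set x in s]) ->
  (forall a b, a \in [:: a0; a1; a2] -> b \in [:: b0; b1; b2] -> adj e a b) ->
  K33_in e S.
Proof.
move=> syme u6 s6 c6 adj6.
pose ss := [:: a0; a1; a2; b0; b1; b2].
have fl : flatten ss = a0 ++ a1 ++ a2 ++ b0 ++ b1 ++ b2 by rewrite /= cats0.
(* The side [false] takes positions 0 to 2 of [ss], the side [true] positions 3 to 5. *)
pose ix (u : bool * 'I_3) : nat := u.1 * 3 + u.2.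
have ix6 u : ix u < 6 by rewrite /ix; case: u => [[] [i lti]] /=; lia.
have ss_ix u : nth [::] ss (ix u) \in ss by apply: mem_nth; apply: ix6.
have lo (i : 'I_3) : nth [::] ss (ix (false, i)) \in [:: a0; a1; a2].
  by case: i => [[|[|[|]]] //= _]; rewrite /ix /= !inE eqxx ?orbT.
have hi (i : 'I_3) : nth [::] ss (ix (true, i)) \in [:: b0; b1; b2].
  by case: i => [[|[|[|]]] //= _]; rewrite /ix /= !inE eqxx ?orbT.
have adjB u v : K33_rel u v -> adj e (nth [::] ss (ix u)) (nth [::] ss (ix v)).
  case: u v => [[] i] [[] j] // _; last exact: adj6.
  have [x [y [xs ys exy]]] := adj6 _ _ (lo j) (hi i).
  by exists y, x; split=> //; rewrite syme.
exists (fun u => [set x in nth [::] ss (ix u)]); split.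
- move=> u; apply/subsetP => x; rewrite inE => xu; apply: s6; rewrite -fl.
  by apply/flattenP; exists (nth [::] ss (ix u)).
- move=> u; have /adjB[x [y [xu _ _]]] : K33_rel u (~~ u.1, ord0).
    by rewrite /K33_rel; case: u.1.
  by apply/set0Pn; exists x; rewrite inE.
- move=> u v uv; have ne : ix u != ix v.
    apply: contra uv => /eqP; case: u v => [b i] [c j]; rewrite /ix /= => eqi.
    have [li lj] := (ltn_ord i, ltn_ord j).
    apply/eqP; congr (_, _); first by case: b c eqi => [] []; lia.
    by apply/val_inj; case: b c eqi => [] [] /=; lia.
  rewrite disjoint_subset; apply/subsetP => x; rewrite !inE => xu.
  apply/negP => xv; suff: false by []; apply: (uniq_flatten_nth _ ne xu xv).
  by rewrite fl.
- by move=> u; apply: c6.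
- by move=> u v /adjB[x [y [xs ys exy]]]; exists x, y; rewrite !inE.
Qed.

Lemma card_cliques_in_le e S : #|cliques_in e S| <= 2 ^ #|S|.
Proof.
rewrite -card_powerset; apply/subset_leq_card/subsetP => A.
by rewrite !inE => /andP[].
Qed.

(** * Contraction of an edge, and gluing along a clique *)

(** The vertex [u] inherits the neighbours of [v], which stays in the type and is discarded by
    restricting to [S :\ v]. The test [x != y] prevents the loop at [u] that [e v u] would
    create. *)
Definition contract e (u v : T) : rel T := fun x y =>
  (x != y) && [|| e x y, (x == u) && e v y | (y == u) && e v x].

Lemma contract_simple e u v : simple_graph e -> simple_graph (contract e u v).
Proof.
case=> syme irre; split=> [x y|x]; rewrite /contract; last by rewrite eqxx.
by rewrite eq_sym (syme x y) [(x == u) && _ || _]orbC.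
Qed.

(** The branch set containing [u], if there is one, gets [v] back; every edge created by the
    contraction is then realised through [v]. *)
Lemma K33_in_contract e u v S :
  simple_graph e -> u \in S -> v \in S -> e u v ->
  K33_in (contract e u v) (S :\ v) -> K33_in e S.
Proof.
move=> [syme irre] uS vS euv [B [sB n0 dB cB eB]].
pose B' w := if u \in B w then v |: B w else B w.
have sBB' w : B w \subset B' w by rewrite /B'; case: ifP => // _; apply: subsetUr.
have vB w : v \in B w = false.
  by apply/negbTE/negP => /(subsetP (sB w)); rewrite !inE eqxx.
have B'P w x : x \in B' w -> x = v /\ u \in B w \/ x \in B w.
  rewrite /B'; case: ifP => uw; last by right.
  by rewrite !inE => /orP[/eqP|]; auto.
have vB' w : u \in B w -> v \in B' w by rewrite /B' => ->; rewrite setU11.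
have dis w w' x : w != w' -> x \in B w -> x \in B w' -> False.
  by move=> /dB; rewrite disjoint_subset => /subsetP/(_ x) h /h; rewrite inE => /negP.
exists B'; split.
- move=> w; apply/subsetP => x /B'P[[-> _] //|/(subsetP (sB w))].
  by rewrite inE => /andP[].
- move=> w; have /set0Pn[x xw] := n0 w; apply/set0Pn; exists x.
  exact: (subsetP (sBB' w)).
- move=> w w' ww'; rewrite disjoint_subset; apply/subsetP => x xw; rewrite inE.
  apply/negP => xw'.
  have [[xv uw]|xw1] := B'P _ _ xw; have [[xv' uw']|xw1'] := B'P _ _ xw'.
  + exact: dis ww' uw uw'.
  + by rewrite xv vB in xw1'.
  + by rewrite xv' vB in xw1.
  + exact: dis ww' xw1 xw1'.
- move=> w.
  pose r := [rel x y | [&& e x y, x \in B' w & y \in B' w]].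
  have symr : symmetric r by move=> x y; rewrite /= syme [(_ \in _) && _]andbC.
  have step x y : e x y -> x \in B' w -> y \in B' w -> connect r x y.
    by move=> exy xw yw; apply: connect1; rewrite /= exy xw yw.
  have sub x y : x \in B w -> y \in B w -> connect r x y.
    move=> xw yw; apply: connect_sub (cB w x y xw yw) => {xw yw} {}x {}y.
    move=> /and3P[/andP[_ /or3P[exy|/andP[/eqP-> evy]|/andP[/eqP-> evx]]] xw yw].
    + by apply: step => //; apply: (subsetP (sBB' w)).
    + apply: (@connect_trans _ _ v); last by apply: step; rewrite ?vB' ?(subsetP (sBB' w)).
      by apply: step; rewrite ?vB' ?(subsetP (sBB' w)).
    + apply: (@connect_trans _ _ v); last by apply: step; rewrite ?vB' ?(subsetP (sBB' w)) // syme.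
      by apply: step; rewrite ?vB' ?(subsetP (sBB' w)) // syme.
  have toB x : x \in B' w -> exists2 y, y \in B w & connect r x y.
    move=> xw; have [[xv uw]|xw1] := B'P _ _ xw; last by exists x.
    exists u => //; apply: step => //; first by rewrite xv syme.
    exact: (subsetP (sBB' w)).
  move=> x y /toB[x' x'w xx'] /toB[y' y'w yy']; apply: connect_trans xx' _.
  by apply: connect_trans (sub _ _ x'w y'w) _; rewrite (sym_connect_sym symr).
- move=> w w' /eB[x [y [xw yw' /andP[_ /or3P[exy|/andP[/eqP xu evy]|/andP[/eqP yu evx]]]]]].
  + by exists x, y; split=> //; apply: (subsetP (sBB' _)).
  + by exists v, y; rewrite vB' -?xu // (subsetP (sBB' _)).
  + by exists x, v; rewrite vB' -?yu // (subsetP (sBB' _)) // syme.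
Qed.

(* A clique A of e with v \in A either lies in {u, v} together with the common
   neighbourhood, or becomes a new clique of the contraction once v is replaced
   by u. *)
Lemma card_cliques_contract e u v S :
  simple_graph e -> u \in S -> v \in S -> e u v ->
  #|cliques_in e S| <= #|cliques_in (contract e u v) (S :\ v)|
                       + 2 * #|cliques_in e [set x in S | e u x && e v x]|.
Proof.
move=> [syme irre] uS vS euv; set N := [set x in S | _]; set e' := contract e u v.
have uv : u != v by apply: contraTneq euv => ->; rewrite irre.
(* [X0] and [X2] inject together into the cliques of the contraction; [X1] accounts for the loss. *)
pose X0 := [set A in cliques_in e S | v \notin A].
pose X1 := [set A in cliques_in e S | (v \in A) && (A :\ v :\ u \subset N)].
pose X2 := [set A in cliques_in e S | (v \in A) && ~~ (A :\ v :\ u \subset N)].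
have defS : cliques_in e S = X0 :|: X1 :|: X2.
  apply/setP => A; rewrite /X0 /X1 /X2 !in_set.
  by case: (_ && _) => //=; case: (v \in A) => //=; case: (_ \subset N).
have e_e' x y : e x y -> e' x y.
  by move=> exy; rewrite /e' /contract exy andbT; apply: contraTneq exy => ->; rewrite irre.
have leX1 : #|X1| <= 2 * #|cliques_in e N|.
  (* The factor 2: a clique in [X1] is determined by its trace on [N] and by whether it contains
     [u]. *)
  pose g (p : bool * {set T}) := if p.1 then u |: (v |: p.2) else v |: p.2.
  rewrite -card_bool -cardsT -cardsX; apply: leq_trans (leq_imset_card g _).
  apply/subset_leq_card/subsetP => A; rewrite !inE -/(cliques_in e S).
  move=> /andP[/andP[sA /is_cliqueP cA] /andP[vA sN]].
  apply/imsetP; exists (u \in A, A :\ v :\ u).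
    rewrite in_setX in_setT; apply/cliques_inP; split=> // x y.
    by rewrite !inE => /and3P[_ _ xA] /and3P[_ _ yA]; apply: cA.
  rewrite /g /=; case: ifP => uA; apply/setP => x; rewrite !inE.
    by case: (x =P u) => [->//|_]; case: (x =P v) => [->//|_].
  by case: (x =P v) => [->//|_] /=; case: (x =P u) => [->|].
(* A clique in [X2] has a vertex not adjacent to [u], so it omits [u] and replacing [v] by [u] is
   injective. The image contains a pair not adjacent in [e], so it is not in [X0]. *)
pose h A := u |: (A :\ v).
have X2P A : A \in X2 -> [/\ A \subset S, is_clique e A, v \in A, u \notin A &
    exists2 x, x \in A :\ v & ~~ e u x].
  rewrite !inE => /andP[/andP[sA cA] /andP[vA /subsetPn[x]]].
  rewrite !inE => /and3P[xu xv xA] xN.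
  have evx : e v x by apply: (is_cliqueP _ _ cA) => //; rewrite eq_sym.
  have eux : ~~ e u x by move: xN; rewrite (subsetP sA) //= evx andbT.
  split=> //; last by exists x; rewrite // !inE xv.
  by apply: contra eux => uA; apply: (is_cliqueP _ _ cA) => //; rewrite eq_sym.
have h_inj : {in X2 &, injective h}.
  move=> A A' /X2P[_ _ vA uA _] /X2P[_ _ vA' uA' _] /setP eqh; apply/setP => x.
  have := eqh x; rewrite !inE; case: (x =P v) => [->|_]; first by rewrite vA vA'.
  by case: (x =P u) => [->|_] //=; rewrite (negbTE uA) (negbTE uA').
have dis : [disjoint X0 & h @: X2].
  rewrite disjoint_sym disjoint_subset; apply/subsetP => _ /imsetP[A /X2P[_ _ _ uA [x xA eux]] ->].
  rewrite inE; apply/negP; rewrite !inE => /andP[/andP[_ /is_cliqueP cl] _].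
  case/negP: eux; apply: cl; rewrite ?in_setU1 ?eqxx ?xA ?orbT //.
  by apply: contraNneq uA => ux; move: xA; rewrite -ux inE => /andP[].
have sub : X0 :|: h @: X2 \subset cliques_in e' (S :\ v).
  apply/subsetP => A; rewrite in_setU => /orP[|/imsetP[{}A /X2P[sA /is_cliqueP cA vA uA _] ->]].
    rewrite !inE => /andP[/andP[sA /is_cliqueP cA] vA].
    rewrite subsetD1 sA vA; apply/is_cliqueP => x y xA yA xy; apply/e_e'.
    exact: cA.
  apply/cliques_inP; split.
    apply/subsetP => x; rewrite !inE => /orP[/eqP ->|/andP[-> /(subsetP sA)//]].
    by rewrite uv.
  move=> x y; rewrite !inE => /orP[/eqP ->|/andP[xv xA]] /orP[/eqP ->|/andP[yv yA]] xy.
  - by rewrite eqxx in xy.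
  - have evy : e v y by apply: cA; rewrite // eq_sym.
    by rewrite /e' /contract xy eqxx evy orbT.
  - have evx : e v x by apply: cA; rewrite // eq_sym.
    by rewrite /e' /contract xy eqxx evx !orbT.
  - by apply/e_e'/cA.
have := subset_leq_card sub; rewrite cardsU disjoint_setI0 // cards0 card_in_imset // subn0.
move=> leX02; rewrite defS; apply: leq_trans (leq_card_setU _ _).1 _.
apply: leq_trans (leq_add (leq_card_setU _ _).1 (leqnn _)) _.
by rewrite addnAC leq_add.
Qed.

(** No clique meets both [S1 :\: S2] and [S2 :\: S1], so each lies in one of the two parts, and the
    subsets of [Q] are counted twice. *)
Lemma card_cliques_clique_sum e S1 S2 Q :
  is_clique e Q -> Q \subset S1 -> Q \subset S2 ->
  (forall x y, x \in S1 -> x \notin S2 -> y \in S2 -> y \notin S1 -> ~~ e x y) ->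
  #|cliques_in e (S1 :|: S2)| + 2 ^ #|Q| <= #|cliques_in e S1| + #|cliques_in e S2|.
Proof.
move=> /is_cliqueP cQ sQ1 sQ2 noe.
rewrite -cardsUI -card_powerset; apply: leq_add; apply/subset_leq_card/subsetP => A.
  move=> /cliques_inP[sA cA]; rewrite !inE.
  have -> : is_clique e A by apply/is_cliqueP.
  rewrite !andbT; case: (boolP (A \subset S2)) => [_|/subsetPn[x xA x2]]; rewrite ?orbT //.
  rewrite orbF; apply/subsetP => y yA; apply: contraT => y1.
  have x1 : x \in S1 by have := subsetP sA x xA; rewrite inE (negbTE x2) orbF.
  have y2 : y \in S2 by have := subsetP sA y yA; rewrite inE (negbTE y1).
  have /negP[] := noe x y x1 x2 y2 y1; apply: cA => //.
  by apply: contraNneq x2 => ->.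
rewrite !inE => sA; rewrite !(subset_trans sA) //=.
have -> : is_clique e A; last by [].
by apply/is_cliqueP => x y xA yA; apply: cQ; apply: (subsetP sA).
Qed.

(** * Paths in the link of a vertex *)

(** The vertex [v] is adjacent to the whole link, so it joins [h1] and [h2] as the third branch set
    of their side. *)
Lemma K33_of_K23_in_link e S v (h1 h2 c0 c1 c2 : seq T) :
  simple_graph e -> v \in S ->
  uniq (h1 ++ h2 ++ c0 ++ c1 ++ c2) ->
  {subset h1 ++ h2 ++ c0 ++ c1 ++ c2 <= [set x in S | e v x]} ->
  (forall s, s \in [:: h1; h2; c0; c1; c2] -> sorted e s) ->
  (forall h c, h \in [:: h1; h2] -> c \in [:: c0; c1; c2] -> adj e h c) ->
  K33_in e S.
Proof.
move=> [syme irre] vS u5 s5 p5 adj5.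
apply: (@K33_of_seqs e S [:: v] h1 h2 c0 c1 c2) => //.
- rewrite cat_uniq u5 andbT /=; apply/hasPn => x /s5; rewrite !inE => /andP[_].
  by apply: contraTneq => ->; rewrite irre.
- by move=> x; rewrite inE => /predU1P[->//|/s5]; rewrite inE => /andP[].
- move=> s; rewrite inE => /predU1P[->|/p5]; last exact: connected_in_path.
  exact: connected_in_path.
move=> a b; rewrite inE => /predU1P[->|ah bc]; last exact: adj5.
move=> bc; have [_ [y [_ yb _]]] := adj5 h1 b (mem_head _ _) bc.
exists v, y; split=> //; first exact: mem_head.
have : y \in [set x in S | e v x]; last by rewrite inE => /andP[].
apply: s5; rewrite !mem_cat.
by move: bc yb; rewrite !inE => /or3P[] /eqP -> ->; rewrite ?orbT.
Qed.

Definition has_K5 e S : Prop :=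
  exists Q : {set T}, [/\ Q \subset S, is_clique e Q & #|Q| = 5].

Lemma is_clique_pairwise e s :
  symmetric e -> pairwise e s -> is_clique e [set x in s].
Proof.
move=> syme; elim: s => [|x s IH] /=; first by move=> _; apply/is_cliqueP => ? ?; rewrite inE.
move=> /andP[/allP ex /IH/is_cliqueP cl]; apply/is_cliqueP => a b.
rewrite !in_set !inE => /predU1P[->|as_] /predU1P[->|bs_]; rewrite ?eqxx // => ab.
- exact: ex.
- by rewrite syme; apply: ex.
- by apply: cl; rewrite ?in_set.
Qed.

Definition link_path e (N : {set T}) s : bool :=
  [&& uniq s, sorted e s & all [in N] s].

Lemma adj_mem e (s t : seq T) x y : x \in s -> y \in t -> e x y -> adj e s t.
Proof. by move=> xs yt exy; exists x, y. Qed.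

Lemma adj_path e x s : path e x s -> s != [::] -> adj e [:: x] s.
Proof. by case: s => //= y s /andP[exy _] _; exists x, y; rewrite !mem_head. Qed.

Lemma adjC e (s t : seq T) : symmetric e -> adj e s t -> adj e t s.
Proof. by move=> syme [x [y [xs yt exy]]]; exists y, x; rewrite syme. Qed.

Lemma adjS e (s t s' : seq T) : {subset s <= s'} -> adj e s t -> adj e s' t.
Proof. by move=> ss' [x [y [xs yt exy]]]; exists x, y; split=> //; apply: ss'. Qed.

(** In the [K_{2,3}] model, [y] and the segment ending in [a] face [x], [z] and the segment ending
    in [b]. *)
Lemma triangle_two_exits e S v x y z (r1 r2 r3 : seq T) a b :
  simple_graph e -> v \in S ->
  link_path e [set x in S | e v x] (x :: y :: z :: rcons r1 a ++ rcons r2 b ++ r3) ->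
  e x z -> e x a -> e y b -> K33_in e S.
Proof.
move=> [syme irre] vS /and3P[us ps /allP Ns] exz exa eyb.
have pe : perm_eq (([:: y] ++ rcons r1 a ++ rcons r2 b ++ [:: x] ++ [:: z]) ++ r3)
   (x :: y :: z :: rcons r1 a ++ rcons r2 b ++ r3) by perm_count.
move: ps => /= /and3P[exy eyz]; rewrite !cat_path !last_rcons => /and3P[p1 p2 _].
have r1a : rcons r1 a != [::] by case: (r1).
have r2b : rcons r2 b != [::] by case: (r2).
apply: (@K33_of_K23_in_link e S v [:: y] (rcons r1 a) (rcons r2 b) [:: x] [:: z]) => //.
- by move: us; rewrite -(perm_uniq pe) cat_uniq => /and3P[].
- by move=> w wi; apply: Ns; rewrite -(perm_mem pe) mem_cat wi.
- move=> s; rewrite !inE => /or4P[|||/orP[]] /eqP -> //.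
  + exact: path_sorted p1.
  + exact: path_sorted p2.
move=> h c; rewrite !inE => /orP[]/eqP -> /or3P[]/eqP ->.
- by apply: (adj_mem _ _ eyb); rewrite ?mem_rcons mem_head.
- by apply: adj_path; rewrite //= syme exy.
- by apply: adj_path; rewrite //= eyz.
- apply: (adjS _ (adj_path p2 r2b)) => w; rewrite inE => /eqP ->.
  by rewrite mem_rcons mem_head.
- by rewrite syme in exa; apply: (adj_mem _ _ exa); rewrite ?mem_rcons mem_head.
- exact/adjC/adj_path.
Qed.

(** A Pósa rotation: the chord from [x] to [z] replaces the edge from [y] to [z], and the initial
    segment is reversed. *)
Lemma link_path_rotate e N x mid y z rest :
  symmetric e -> e x z -> link_path e N (x :: mid ++ y :: z :: rest) ->
  link_path e N (y :: rev mid ++ x :: z :: rest).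
Proof.
move=> syme exz /and3P[us + /allP Ns].
have pe : perm_eq (x :: mid ++ y :: z :: rest) (y :: rev mid ++ x :: z :: rest) by perm_count.
rewrite -[mid ++ _]cat_rcons /= cat_path last_rcons => /andP[pm /= /andP[_ pr]].
apply/and3P; split; first by rewrite -(perm_uniq pe).
  2: by apply/allP => t; rewrite -(perm_mem pe); apply: Ns.
rewrite /= -cat_rcons cat_path last_rcons /= exz pr !andbT.
have -> : rcons (rev mid) x = rev (belast x (rcons mid y)) by rewrite belast_rcons rev_cons.
have {1}<- : last x (rcons mid y) = y by rewrite last_rcons.
by rewrite rev_path (eq_path (e' := e)) // => a b; rewrite syme.
Qed.

Lemma link_two_chords e S v x mid y z rest w w' :
  simple_graph e -> v \in S ->
  link_path e [set x in S | e v x] (x :: mid ++ y :: z :: rest) ->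
  e x z -> w \in rest -> e x w -> w' \in rest -> e y w' ->
  K33_in e S \/ has_K5 e S.
Proof.
move=> sg vS lp exz wr exw wr' eyw'; have [syme irre] := sg.
(* If [mid] is empty, [x], [y], [z] form a triangle, and the positions of [w] and [w'] decide. *)
case: mid lp => [|m0 mid] lp.
  have swap r : link_path e [set x in S | e v x] (x :: y :: z :: r) ->
      link_path e [set x in S | e v x] (y :: x :: z :: r).
    move=> /and3P[u + /allP N] => /= /and3P[exy eyz p].
    have pe : perm_eq (x :: y :: z :: r) (y :: x :: z :: r) by perm_count.
    apply/and3P; split; [by rewrite -(perm_uniq pe) | by rewrite /= syme exy exz p |].
    by apply/allP => t; rewrite -(perm_mem pe); apply: N.
  move: (lp) => /and3P[us + /allP Ns] => /= /and3P[exy eyz ps].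
  have [eqw|neqw] := eqVneq w w'.
    rewrite -eqw in eyw'; case/splitPr: wr lp us ps Ns => r1 r2 lp us ps Ns.
    (* If the common neighbour [w] directly follows [z], then [v], [x], [y], [z], [w] form a [K5].
       Otherwise [z] and [w] face [x], [y] and the segment between them. *)
    case: r1 lp us ps Ns => [|t r1] lp us /= ps Ns; [right|left].
      have pw : pairwise e [:: v; x; y; z; w].
        move: ps => /andP[ezw _]; rewrite /= exy exz exw eyz eyw' ezw !andbT.
        have evN t : t \in [:: x, y, z, w & r2] -> e v t by move/Ns; rewrite inE => /andP[].
        by rewrite !evN // !inE eqxx ?orbT.
      exists [set t in [:: v; x; y; z; w]]; split.
      - apply/subsetP => t; rewrite in_set inE => /predU1P[->//|ti].
        have /Ns : t \in [:: x, y, z, w & r2].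
          by move: ti; rewrite !inE => /or4P[] ->; rewrite ?orbT.
        by rewrite inE => /andP[].
      - exact: is_clique_pairwise.
      - by rewrite cardsE; apply/card_uniqP; apply: pairwise_uniq pw.
    have pe : perm_eq (([:: z] ++ [:: w] ++ [:: x] ++ [:: y] ++ (t :: r1)) ++ r2)
       (x :: y :: z :: (t :: r1) ++ w :: r2) by perm_count.
    move: ps; rewrite cat_path /= => /and3P[ezt p1 /andP[lw _]].
    apply: (@K33_of_K23_in_link e S v [:: z] [:: w] [:: x] [:: y] (t :: r1)) => //.
    - by move: us; rewrite -(perm_uniq pe) cat_uniq => /and3P[].
    - by move=> u ui; apply: Ns; rewrite -(perm_mem pe) mem_cat ui.
    - by move=> s; rewrite !inE => /or4P[|||/orP[]] /eqP ->.
    move=> h c; rewrite !inE => /orP[]/eqP -> /or3P[]/eqP ->.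
    - by apply: adj_path; rewrite //= syme exz.
    - by apply: adj_path; rewrite //= syme eyz.
    - by apply: adj_path; rewrite //= ezt.
    - by apply: adj_path; rewrite //= syme exw.
    - by apply: adj_path; rewrite //= syme eyw'.
    - by apply/adjC => //; apply: (adj_mem _ _ lw); rewrite ?mem_last ?mem_head.
  (* For distinct [w] and [w'], the roles of [x] and [y] are exchanged when [w'] comes first. *)
  left; case/splitPr: wr lp wr' => r1 r2 lp; rewrite mem_cat inE.
  rewrite eq_sym (negbTE neqw) /= => /orP[] /splitPr defr; case: defr lp => p1 p2 lp.
    apply: (@triangle_two_exits e S v y x z p1 p2 r2 w' w) => //.
    by apply: swap; move: lp; rewrite !cat_rcons -catA.
  apply: (@triangle_two_exits e S v x y z r1 p1 p2 w w') => //.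
  by move: lp; rewrite !cat_rcons.
(* For nonempty [mid], the vertices [x] and [y] face [mid], [z] and [rest]. *)
left; move: (lp) => /and3P[us + /allP Ns] => /= /andP[exm].
rewrite cat_path /= => /and4P[pm lm eyz pr].
have pe : perm_eq ([:: x] ++ [:: y] ++ (m0 :: mid) ++ [:: z] ++ rest)
       (x :: (m0 :: mid) ++ y :: z :: rest) by perm_count.
apply: (@K33_of_K23_in_link e S v [:: x] [:: y] (m0 :: mid) [:: z] rest) => //.
- by rewrite (perm_uniq pe).
- by move=> u ui; apply: Ns; rewrite -(perm_mem pe).
- by move=> s; rewrite !inE => /or4P[|||/orP[]] /eqP -> //; apply: path_sorted pr.
move=> h c; rewrite !inE => /orP[]/eqP -> /or3P[]/eqP ->.
- by apply: adj_path; rewrite //= exm.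
- by apply: adj_path; rewrite //= exz.
- by apply: (adj_mem _ _ exw); rewrite ?mem_head.
- by apply/adjC => //; apply: (adj_mem _ _ lm); rewrite ?mem_last ?mem_head.
- by apply: adj_path; rewrite //= eyz.
- by apply: (adj_mem _ _ eyw'); rewrite ?mem_head.
Qed.

Lemma exists_third (A : {set T}) a b :
  2 < #|A| -> exists2 x, x \in A & (x != a) && (x != b).
Proof.
move=> A3; have /set0Pn[x] : A :\: [set a; b] != set0.
  rewrite -card_gt0 cardsD subn_gt0; apply: leq_ltn_trans A3.
  by apply: leq_trans (subset_leq_card (subsetIr _ _)) _; rewrite cards2; case: (a != b).
by rewrite !inE negb_or => /andP[xab xA]; exists x.
Qed.

Lemma dense_link e S v :
  simple_graph e -> v \in S -> [set x in S | e v x] != set0 ->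
  (forall x, x \in S -> e v x -> 2 < #|[set y in S | e v y && e x y]|) ->
  K33_in e S \/ has_K5 e S.
Proof.
move=> sg vS /set0Pn[x0 x0N] deg3; have [syme irre] := sg.
set N := [set x in S | e v x] in x0N *.
(* The measure is the room left for a longer path: a duplicate-free path has at most [#|T|]
   vertices. *)
suff ext m s : #|T| - size s < m -> link_path e N s -> s != [::] ->
    K33_in e S \/ has_K5 e S.
  apply: (ext #|T|.+1 [:: x0]) => //; first by rewrite ltnS leq_subr.
  by rewrite /link_path /= x0N.
elim: m s => // m IHm s szs lps s0.
have degN x a b : x \in N -> exists w, [/\ w \in N, e x w, w != a & w != b].
  rewrite inE => /andP[xS evx].
  have [w] := exists_third a b (deg3 x xS evx); rewrite !inE => /and3P[wS evw exw] /andP[wa wb].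
  by exists w; rewrite inE wS evw.
(* The outer induction makes the path longest; the inner one minimises mid. *)
have ext x p w : size (x :: p) = size s -> link_path e N (x :: p) -> w \in N ->
    e x w -> w \notin x :: p -> K33_in e S \/ has_K5 e S.
  move=> sz /and3P[u p' aN] wN exw wp; apply: (IHm (w :: x :: p)) => //.
    have : size (w :: x :: p) <= #|T|.
      have /card_uniqP <- : uniq (w :: x :: p) by rewrite cons_uniq wp.
      exact: max_card.
    by move: szs; rewrite -sz /=; clear; lia.
  by apply/and3P; split; [rewrite cons_uniq wp | rewrite /= syme exw | rewrite /= wN].
have inner k x mid y z rest : size mid < k ->
    size (x :: mid ++ y :: z :: rest) = size s ->
    link_path e N (x :: mid ++ y :: z :: rest) -> e x z ->
    K33_in e S \/ has_K5 e S.
  elim: k x mid y z rest => // k IHk x mid y z rest szm sz lp exz.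
  have third x1 mid1 y1 : size mid1 = size mid ->
      size (x1 :: mid1 ++ y1 :: z :: rest) = size s ->
      link_path e N (x1 :: mid1 ++ y1 :: z :: rest) ->
      (K33_in e S \/ has_K5 e S) \/ exists2 w, w \in rest & e x1 w.
    move=> szm1 sz1 lp1.
    have x1N : x1 \in N by case/and3P: lp1 => _ _ /= /andP[].
    (* Avoiding the successor of [x1] and [z], the neighbour [w] is off the path and extends it, or
       lies before [z] and gives a chord with a smaller [mid], or lies beyond [z]. *)
    have [w [wN ex1w wh wz]] := degN x1 (head y1 mid1) z x1N.
    have [wp|wp] := boolP (w \in x1 :: mid1 ++ y1 :: z :: rest); last first.
      by left; apply: (ext x1 _ w) wp.
    have wx1 : w != x1 by apply: contraTneq ex1w => ->; rewrite irre.
    move: wp; rewrite inE (negbTE wx1) /= -cat_rcons mem_cat inE (negbTE wz) /=.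
    move=> /orP[wm|wr]; last by right; exists w.
    left; have defm : rcons mid1 y1 ++ z :: rest = mid1 ++ y1 :: z :: rest by rewrite cat_rcons.
    have hd : head y1 mid1 = head y1 (rcons mid1 y1) by case: (mid1).
    have szr : size (rcons mid1 y1) = (size mid).+1 by rewrite size_rcons szm1.
    rewrite -defm in sz1 lp1; rewrite hd in wh.
    case/splitPr: wm szr wh sz1 lp1 => m1 m2; case/lastP: m1 => [|m1 t] szr wh sz1 lp1.
      by rewrite /= eqxx in wh.
    apply: (IHk x1 m1 t w (m2 ++ z :: rest)) => //.
    - by move: szr szm; rewrite size_cat size_rcons /=; clear; lia.
    - by rewrite -sz1 cat_rcons -catA.
    - by move: lp1; rewrite cat_rcons -catA.
  have [//|[w wr exw]] := third x mid y erefl sz lp.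
  (* Rotation preserves the length of the path and of [mid], so the same alternatives hold for
     [y]. *)
  have [||//|[w' wr' eyw']] := third y (rev mid) x (size_rev _).
  - by rewrite -sz /= !size_cat size_rev.
  - exact: link_path_rotate.
  exact: link_two_chords sg vS lp exz wr exw wr' eyw'.
case: s s0 szs lps ext inner => // x p _ szs lps ext inner.
have xN : x \in N by case/and3P: lps => _ _ /= /andP[].
(* The first chord avoids the successor of [x]. For empty [p] the default [x] is harmless, since [w]
   then lies off the path. *)
have [w [wN exw wh _]] := degN x (head x p) x xN.
have [wp|wp] := boolP (w \in x :: p); last exact: (ext x p w).
have wx : w != x by apply: contraTneq exw => ->; rewrite irre.
move: wp; rewrite inE (negbTE wx) /= => wp.
case/splitPr: wp wh lps inner => m1 m2; case/lastP: m1 => [|m1 t] wh lps inner.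
  by rewrite /= eqxx in wh.
rewrite cat_rcons in lps inner.
by apply: (inner (size m1).+1 x m1 t w m2).
Qed.

(** * Splitting along a [K5] *)

Lemma component_connected e (D : {set T}) w :
  symmetric e -> w \in D ->
  let C := [set y | connect [rel x y | [&& e x y, x \in D & y \in D]] w y] in
  [/\ C \subset D, connected_in e C &
      forall x y, x \in C -> y \in D -> e x y -> y \in C].
Proof.
move=> syme wD; set r := [rel x y | _]; set C := [set y | _].
have CD : C \subset D.
  have clD : closed r [in D] by move=> x y /and3P[_ xD yD]; rewrite /= xD yD.
  by apply/subsetP => y; rewrite inE => /(closed_connect clD) <-.
have CE x y : x \in C -> y \in D -> e x y -> y \in C.
  move=> xC yD exy; have xD := subsetP CD x xC.
  move: xC; rewrite !inE => wx; apply: connect_trans wx _.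
  by apply: connect1; rewrite /= exy xD.
split=> //; pose rC := [rel x y | [&& e x y, x \in C & y \in C]].
have symr : symmetric rC by move=> x y; rewrite /= syme [(_ \in _) && _]andbC.
have wC y : y \in C -> connect rC w y.
  rewrite inE => /connectP[p pp ->] {y}.
  elim/last_ind: p pp => [|p y IH]; first by rewrite connect0.
  rewrite last_rcons rcons_path => /andP[pp /and3P[ely lD yD]].
  apply: connect_trans (IH pp) _.
  have lC : last w p \in C by rewrite inE; apply/connectP; exists p.
  by apply: connect1; rewrite /= ely lC (CE (last w p)).
move=> x y /wC wx /wC; apply: connect_trans.
by rewrite (sym_connect_sym symr).
Qed.

(** Three vertices of [Q] with neighbours in [C] form one side; [C] and the other two vertices of
    [Q] form the other. *)
Lemma K33_of_K5_and_component e S Q C :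
  simple_graph e -> Q \subset S -> is_clique e Q -> #|Q| = 5 ->
  C \subset S :\: Q -> connected_in e C ->
  2 < #|[set q in Q | [exists c in C, e c q]]| -> K33_in e S.
Proof.
move=> [syme irre] sQ /is_cliqueP eQ cQ CD conC; set A := [set q in Q | _] => A3.
have AQ : A \subset Q by apply/subsetP => q; rewrite inE => /andP[].
have [X [_ XA cX]] : exists X : {set T}, [/\ set0 \subset X, X \subset A & #|X| = 3].
  by apply: subset_of_card; rewrite ?sub0set // cards0.
have XQ := subset_trans XA AQ; set Y := Q :\: X.
have cY : #|Y| = 2 by rewrite cardsD (setIidPr XQ) cQ cX.
(* This one permutation yields both the disjointness of the six branch sets and their inclusion in
   [S]. *)
have pe : perm_eq (enum C ++ enum Y ++ enum X) (enum (C :|: Q)).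
  apply: uniq_perm; last 2 first.
  - exact: enum_uniq.
  - move=> x; rewrite !mem_cat !mem_enum !inE.
    by case: (boolP (x \in X)) => [/(subsetP XQ) ->|]; rewrite ?orbF ?orbT.
  rewrite !cat_uniq !enum_uniq /= andbT; apply/andP; split; apply/hasPn => x.
    rewrite mem_cat !mem_enum [in X in X -> _]inE => xYX; apply/negP => /(subsetP CD).
    rewrite inE => /andP[/negP xQ _]; apply: xQ.
    by case/orP: xYX => [/andP[]|/(subsetP XQ)].
  by rewrite !mem_enum inE => ->.
have eC x : x \in enum X -> exists2 c, c \in C & e c x.
  by rewrite mem_enum => /(subsetP XA); rewrite inE => /andP[_ /exists_inP].
have eYX y x : y \in enum Y -> x \in enum X -> e y x.
  rewrite !mem_enum inE => /andP[yX yQ] xX; apply: eQ => //; first exact: (subsetP XQ).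
  by apply: contraNneq yX => ->.
have sX : size (enum X) = 3 by rewrite -cardE.
have sY : size (enum Y) = 2 by rewrite -cardE.
case: (enum X) sX pe eC eYX => [|x1 [|x2 [|x3 []]]] // _.
case: (enum Y) sY => [|y1 [|y2 []]] // _ pe eC eYX.
apply: (@K33_of_seqs e S (enum C) [:: y1] [:: y2] [:: x1] [:: x2] [:: x3]) => //.
- by move: (enum_uniq (C :|: Q)); rewrite -(perm_uniq pe).
- move=> x; rewrite (perm_mem pe) mem_enum in_setU => /orP[/(subsetP CD)|/(subsetP sQ)//].
  by rewrite inE => /andP[].
- move=> s; rewrite inE => /predU1P[->|]; first by rewrite set_enum.
  by rewrite !inE => /or4P[|||/orP[]] /eqP ->; apply: connected_in_path.
move=> a b; rewrite inE => /predU1P[->|ay] bx;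
  have /mapP[x xX ->] : b \in [seq [:: x] | x <- [:: x1; x2; x3]] by [].
  by have [c cC ecx] := eC x xX; exists c, x; rewrite mem_enum mem_head.
have /mapP[y yY ->] : a \in [seq [:: y] | y <- [:: y1; y2]] by [].
by exists y, x; rewrite !mem_head eYX.
Qed.

(** A component [C] of [S :\: Q] attaches to at most two vertices of [Q]; these are padded to a pair
    [Q2]. The parts are [C :|: Q2], which misses three vertices of [Q], and [S :\: C]. *)
Lemma K5_separation e S Q :
  simple_graph e -> ~ K33_in e S -> Q \subset S -> is_clique e Q ->
  #|Q| = 5 -> 5 < #|S| ->
  exists S1 S2 Q2 : {set T},
    [/\ S = S1 :|: S2, is_clique e Q2 /\ #|Q2| = 2,
        Q2 \subset S1 /\ Q2 \subset S2,
        [/\ #|S1| < #|S|, #|S2| < #|S| & #|S1| + #|S2| = #|S| + 2] &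
        forall x y, x \in S1 -> x \notin S2 -> y \in S2 -> y \notin S1 -> ~~ e x y].
Proof.
move=> sg noK sQ clQ cQ S5; have /is_cliqueP eQ := clQ; have [syme irre] := sg.
have [w wD] : exists w, w \in S :\: Q.
  by apply/set0Pn; rewrite -card_gt0 cardsD (setIidPr sQ) cQ subn_gt0.
have [] := component_connected syme wD; set C := [set y | connect _ _ y] => CD conC clC.
have wC : w \in C by rewrite inE connect0.
have CS : C \subset S by apply: subset_trans CD (subsetDl _ _).
have CQ x : x \in C -> x \notin Q by move=> /(subsetP CD); rewrite inE => /andP[].
pose A := [set q in Q | [exists c in C, e c q]].
have AQ : A \subset Q by apply/subsetP => q; rewrite inE => /andP[].
have [A3|A2] := ltnP 2 #|A|; first by case: noK; apply: K33_of_K5_and_component A3.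
have [Q2 [AQ2 Q2Q cQ2]] : exists X : {set T}, [/\ A \subset X, X \subset Q & #|X| = 2].
  by apply: subset_of_card; rewrite // A2 cQ.
clearbody C; have Q2S2 : Q2 \subset S :\: C.
  apply/subsetP => q /(subsetP Q2Q) qQ; rewrite inE (subsetP sQ) // andbT.
  by apply: contraL qQ; apply: CQ.
have dC : #|C :&: Q2| = 0.
  apply/eqP; rewrite cards_eq0; apply/eqP/setP => x; rewrite !inE.
  by apply/negbTE/negP => /andP[xC /(subsetP Q2Q)]; apply/negP; apply: CQ.
have cC : #|C| + 5 <= #|S|.
  by have := subset_leq_card CD; rewrite cardsD (setIidPr sQ) cQ; move: S5; clear; lia.
have C0 : 0 < #|C| by apply/card_gt0P; exists w.
exists (C :|: Q2), (S :\: C), Q2; split.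
- apply/setP => x; rewrite !inE; case: (boolP (x \in C)) => [/(subsetP CS)//|_] /=.
  by case: (boolP (x \in Q2)) => //= /(subsetP Q2Q)/(subsetP sQ) ->.
- by split=> //; apply/is_cliqueP => x y xQ yQ; apply: eQ; apply: (subsetP Q2Q).
- by split=> //; apply: subsetUr.
- by rewrite cardsU dC cQ2 cardsD (setIidPr CS); move: cC C0; clear; split; lia.
move=> x y xS1 xS2 yS2 yS1; apply/negP => exy.
have xC : x \in C.
  by move: xS1; rewrite in_setU => /orP[//|/(subsetP Q2S2)]; rewrite (negbTE xS2).
move: yS2 yS1; rewrite in_setD in_setU negb_or => /andP[yC yS] /andP[_ yQ2].
have [yQ|yQ] := boolP (y \in Q).
  case/negP: yQ2; apply: (subsetP AQ2); rewrite inE yQ.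
  by apply/exists_inP; exists x.
by case/negP: yC; apply: (clC x) => //; rewrite inE yQ.
Qed.

(** * The upper bound *)

Lemma card_cliques_isolated e S v :
  v \in S -> (forall x, x \in S -> ~~ e v x) ->
  #|cliques_in e S| <= (#|cliques_in e (S :\ v)|).+1.
Proof.
move=> vS iso; rewrite -add1n -(cards1 [set v]).
apply: leq_trans (leq_card_setU _ _).1; apply/subset_leq_card/subsetP => A.
move=> /cliques_inP[sA cA]; rewrite !inE subsetD1 sA /=.
have -> : is_clique e A by apply/is_cliqueP.
rewrite andbT orbC -implybE; apply/implyP => vA.
rewrite eqEsubset sub1set vA andbT; apply/subsetP => x xA; rewrite inE.
apply: contraT => xv; have /negP[] := iso x (subsetP sA x xA).
by apply: cA; rewrite // eq_sym.
Qed.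

Lemma cliques_bound e S :
  simple_graph e -> ~ K33_in e S -> 1 < #|S| ->
  3 * #|cliques_in e S| + 44 <= 28 * #|S|.
Proof.
move: {2}#|S| (leqnn #|S|) => n.
(* The relation is generalised as well, because contraction changes it. *)
elim: n S e => [|n IH] S e leSn sg noK S2; first by move: leSn S2; clear; lia.
have [syme irre] := sg.
(* The bound [2 ^ #|S|] suffices for 2 to 5 vertices, with equality at both ends. *)
have [S5|S5] := leqP #|S| 5.
  have := card_cliques_in_le e S.
  by move: S2 S5; case: #|S| => [|[|[|[|[|[|]]]]]] //= _ _; clear; lia.
have [//|nbound] := leqP (3 * #|cliques_in e S| + 44) (28 * #|S|).
have codeg u v : u \in S -> v \in S -> e u v -> 2 < #|[set x in S | e u x && e v x]|.
  move=> uS vS euv; rewrite ltnNge; apply/negP => N2.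
  have cS : #|S| = (#|S :\ v|).+1 by rewrite (cardsD1 v S) vS.
  have := card_cliques_contract sg uS vS euv.
  have := card_cliques_in_le e [set x in S | e u x && e v x].
  have := leq_pexp2l (isT : 0 < 2) N2.
  have := IH (S :\ v) (contract e u v) _ (contract_simple _ _ sg)
    (fun k => noK (K33_in_contract sg uS vS euv k)).
  by move: nbound leSn S5; rewrite cS; clear; lia.
have [v vS] : exists v, v \in S by apply/card_gt0P; apply: ltn_trans S5.
have [N0|Nn0] := eqVneq [set x in S | e v x] set0.
  have cS : #|S| = (#|S :\ v|).+1 by rewrite (cardsD1 v S) vS.
  have := IH (S :\ v) e _ sg (fun k => noK (K33_inS (subsetDl _ _) k)).
  have : #|cliques_in e S| <= (#|cliques_in e (S :\ v)|).+1.
    apply: card_cliques_isolated => // x xS; move/setP/(_ x): N0.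
    by rewrite !inE xS /= => ->.
  by move: nbound leSn S5; rewrite cS; clear; lia.
have [//|[Q [sQ clQ cQ]]] := dense_link sg vS Nn0 (fun x xS => codeg v x vS xS).
have [S1 [S2' [Q2 [defS [clQ2 cQ2] [Q1 Q2'] [lt1 lt2 cS] noe]]]] :=
  K5_separation sg noK sQ clQ cQ S5.
have := card_cliques_clique_sum clQ2 Q1 Q2' noe; rewrite -defS cQ2.
have s1 : S1 \subset S by rewrite defS subsetUl.
have s2 : S2' \subset S by rewrite defS subsetUr.
have := subset_leq_card Q1; have := subset_leq_card Q2'; rewrite cQ2 => c2 c1.
have := IH S1 e _ sg (fun k => noK (K33_inS s1 k)) c1.
have := IH S2' e _ sg (fun k => noK (K33_inS s2 k)) c2.
(* The two additional vertices contribute 56 on the right, which is exactly the second 44 plus 3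
   times the 4 cliques inside [Q2]. *)
by move: nbound leSn lt1 lt2 cS; clear; lia.
Qed.

End Graphs.

(** * The extremal graphs *)

(* Copies of K5 glued along the edge {0, 1}; the other three vertices of the
   g-th copy are those with i.+1 %/ 3 = g, for g >= 1. *)
Definition book n : rel 'I_n :=
  fun i j => (i != j) && [|| i < 2, j < 2 | i.+1 %/ 3 == j.+1 %/ 3].

Definition spine n : {set 'I_n} := [set i : 'I_n | i < 2].

(** Since [i.+1 %/ 3] is 0 exactly on the spine, genuine pages have positive index, whence [g.+1]
    below. *)
Definition page n g : {set 'I_n} := [set i : 'I_n | (i < 2) || (i.+1 %/ 3 == g)].

Lemma book_simple n : simple_graph (@book n).
Proof.
split=> [i j|i]; rewrite /book ?eqxx // eq_sym (orbCA (i < 2)).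
by rewrite (eq_sym (i.+1 %/ 3)).
Qed.

Lemma card_spine n : 2 <= n -> #|spine n| = 2.
Proof.
move=> n2; rewrite -[RHS]card_ord.
rewrite -(card_codom (f := widen_ord n2)); last by move=> i j /(congr1 val) /= /val_inj.
rewrite -cardsE; apply: eq_card => i; rewrite !inE; apply/idP/codomP => [i2|[j ->]] /=.
  by exists (Ordinal i2); apply: val_inj.
exact: ltn_ord.
Qed.

Lemma card_page k g : g < k -> #|page (k * 3 + 2) g.+1| = 5.
Proof.
(* The vertices of the page are 0, 1 and [g * 3 + i] for [i] from 2 to 4. *)
move=> gk; have bnd (i : 'I_5) : (if i < 2 then val i else g * 3 + i) < k * 3 + 2.
  by case: i => i lti /=; case: ifP => _; lia.
pose f i := Ordinal (bnd i).
rewrite -[RHS]card_ord -(card_codom (f := f)); last first.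
  move=> i j /(congr1 val) /=; have := ltn_ord i; have := ltn_ord j.
  by case: ifP => i2; case: ifP => j2 _ _ eqij; apply: val_inj => /=; lia.
apply: eq_card => i; rewrite !inE; apply/idP/codomP => [|[j ->]] /=.
  have [i2 _|i2 /= /eqP ig] := ltnP i 2.
    have i5 : i < 5 by lia.
    by exists (Ordinal i5); apply: val_inj; rewrite /= i2.
  have i5 : i - g * 3 < 5 by lia.
  exists (Ordinal i5); apply: val_inj => /=.
  by case: ifP => ?; lia.
have := ltn_ord j; case: ifP => [-> //|j2 j5]; apply/orP; right; apply/eqP; lia.
Qed.

(** All neighbours of a vertex off the spine lie on its page, so one such vertex fixes the page of
    the clique. *)
Lemma book_clique n A :
  is_clique (@book n) A =
    (A \subset spine n) || [exists g : 'I_(n %/ 3), A \subset page n g.+1].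
Proof.
apply/is_cliqueP/idP => [cA|/orP[sA|/existsP[g /subsetP sA]] i j iA jA ij].
- case: (boolP (A \subset spine n)) => //= /subsetPn[i iA]; rewrite inE => i2.
  have ltg : (i.+1 %/ 3).-1 < n %/ 3 by have := ltn_ord i; lia.
  have eqg : (i.+1 %/ 3).-1.+1 = i.+1 %/ 3 by lia.
  apply/existsP; exists (Ordinal ltg); apply/subsetP => j jA; rewrite inE /= eqg.
  have [->|ij] := eqVneq j i; first by rewrite eqxx orbT.
  have := cA j i jA iA ij; rewrite /book ij /=.
  by rewrite (negbTE i2).
- by have := subsetP sA i iA; rewrite inE /book ij => ->.
- have := sA i iA; have := sA j jA; rewrite !inE /book ij /=.
  by case: (ltnP i 2) => //= _; case: (ltnP j 2) => //= _ /eqP -> /eqP ->.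
Qed.

Lemma page_inter n g h : g != h -> page n g :&: page n h \subset spine n.
Proof.
move=> gh; apply/subsetP => i; rewrite !inE; case: (i < 2) => //= /andP[/eqP ->].
by rewrite (negbTE gh).
Qed.

Lemma spine_page n g : spine n \subset page n g.
Proof. by apply/subsetP => i; rewrite !inE => ->. Qed.

(** The spine has 4 cliques, and each page adds the [2 ^ 5 - 2 ^ 2 = 28] subsets that are not inside
    the spine. *)
Lemma num_cliques_book k : num_cliques (@book (k * 3 + 2)) = 4 + 28 * k.
Proof.
set n := k * 3 + 2; have nk : n %/ 3 = k by rewrite /n; lia.
pose F (g : 'I_k) := powerset (page n g.+1) :\: powerset (spine n).
have -> : num_cliques (@book n) = #|powerset (spine n) :|: \bigcup_g F g|.
  apply: eq_card => A; rewrite inE book_clique nk in_setU powersetE.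
  case: (boolP (A \subset spine n)) => //= nsA.
  apply/existsP/bigcupP => [[g sA]|[g _]].
    by exists g; rewrite // !inE sA nsA.
  by rewrite !inE => /andP[_ sA]; exists g.
have cF g : #|F g| = 28.
  rewrite /F cardsD (setIidPr _) ?card_powerset ?card_page ?card_spine //.
    by rewrite /n; lia.
  by rewrite powersetS spine_page.
have disF g h : g != h -> [disjoint F g & F h].
  move=> gh; rewrite disjoint_subset; apply/subsetP => A; rewrite !inE => /andP[nsA sAg].
  rewrite nsA /=; apply: contra nsA => sAh.
  apply: subset_trans (page_inter (g := g.+1) (h := h.+1) _ _); last by [].
  by rewrite subsetI sAg.
rewrite cardsU disjoint_setI0; last first.
  rewrite disjoint_sym disjoint_subset; apply/subsetP => A /bigcupP[g _].
  by rewrite !inE => /andP[].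
rewrite cards0 subn0 card_powerset card_spine; last by rewrite /n; lia.
congr (_ + _); rewrite -sum1_card partition_disjoint_bigcup //=.
under eq_bigr => g _ do rewrite sum1_card cF.
by rewrite sum_nat_const card_ord mulnC.
Qed.

(* Any two branch sets avoiding the spine lie on a common page, because K33
   minus two vertices is connected; so all six branch sets meet a single page,
   which has only five vertices. *)
Lemma book_K33_free k : 0 < k -> K33_minor_free (@book (k * 3 + 2)).
Proof.
move=> k0 [B [n0 dB cB eB]]; set n := k * 3 + 2 in B n0 dB cB eB.
pose cl (i : 'I_n) := i.+1 %/ 3.
have cl_edge i j : book i j -> i \notin spine n -> j \notin spine n -> cl i = cl j.
  by rewrite /book !inE => /andP[_ /or3P[-> //|-> //|/eqP]].
pose hit u := [exists x in B u, x \in spine n].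
have nhit u x : ~~ hit u -> x \in B u -> x \notin spine n.
  by move=> hu xu; apply: contra hu => xs; apply/exists_inP; exists x.
(* Edges off the spine preserve [cl], so a connected branch set avoiding the spine stays on one
   page. *)
have cl_const u x y : ~~ hit u -> x \in B u -> y \in B u -> cl x = cl y.
  move=> hu xu yu; have clr : closed [rel i j | [&& book i j, i \in B u & j \in B u]]
      [pred i | cl i == cl x].
    move=> i j /and3P[eij iu ju]; rewrite !inE (cl_edge i j) //; exact: nhit hu _.
  have := closed_connect clr (cB u x y xu yu); rewrite !inE eqxx.
  by move=> /esym/eqP.
have cl_adj u v x y : ~~ hit u -> ~~ hit v -> u.1 != v.1 -> x \in B u -> y \in B v ->
    cl x = cl y.
  move=> hu hv uv xu yv; have [a [b [au bv eab]]] := eB u v uv.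
  rewrite (cl_const u x a) // (cl_const v y b) //; apply: cl_edge => //.
    exact: nhit hu _.
  exact: nhit hv _.
(* Two spine vertices cannot meet all three disjoint branch sets of one side. *)
have two (b : bool) : exists i, ~~ hit (b, i).
  apply/existsP; rewrite -negb_forall; apply/negP => /forallP hb.
  have := @disjoint_family_card _ _ B [set u | u.1 == b] (spine n) dB.
  rewrite card_spine; last by rewrite /n; lia.
  have -> : #|[set u : bool * 'I_3 | u.1 == b]| = 3.
    rewrite -[RHS](card_ord 3) -(card_codom (f := pair b)); last by move=> i j [].
    apply: eq_card => -[c i]; rewrite inE /=; apply/eqP/codomP => [->|[j [-> _]]] //.
    by exists i.
  move=> le32; have // : 3 <= 2; apply: le32 => -[c i]; rewrite inE /= => /eqP ->.
  by have /exists_inP[x] := hb i; exists x.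
have [i0 h0] := two false; have [i1 h1] := two true.
have /set0Pn[x0 x0B] := n0 (false, i0); have /set0Pn[x1 x1B] := n0 (true, i1).
have cl01 : cl x0 = cl x1 by apply: cl_adj h0 h1 _ x0B x1B.
have x0s := nhit _ _ h0 x0B.
have ltg : (cl x0).-1 < k.
  by have := ltn_ord x0; move: x0s; rewrite inE /cl /n; clear -k0; lia.
have eqg : (cl x0).-1.+1 = cl x0 by move: x0s; rewrite inE /cl; clear; lia.
have := @disjoint_family_card _ _ B setT (page n (cl x0)) dB.
rewrite -eqg card_page // eqg cardsT card_prod card_bool card_ord => le65.
have // : 2 * 3 <= 5; apply: le65 => u _.
have [/exists_inP[x xu xs]|hu] := boolP (hit u).
  by exists x => //; apply: (subsetP (spine_page n _)).
have /set0Pn[x xu] := n0 u; exists x => //.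
rewrite inE; apply/orP; right; apply/eqP.
case: u hu xu => [[] i] hu xu; first exact/esym/(cl_adj _ _ _ _ h0 hu).
by rewrite cl01; exact/(cl_adj _ _ _ _ hu h1).
Qed.

(* c(G) <= 4/3 (7n - 11) is written as 3 * c(G) <= 4 * (7n - 11) (7n-11 > 0 as n >= 3). *)
Theorem theorem7 :
  (forall (T : finType) (e : rel T),
      simple_graph e -> 3 <= #|T| -> K33_minor_free e ->
      3 * num_cliques e <= 4 * (7 * #|T| - 11))
  /\
  (forall n : nat, 5 <= n -> n %% 3 = 2 ->
      exists e : rel 'I_n,
        [/\ simple_graph e, K33_minor_free e &
            3 * num_cliques e = 4 * (7 * n - 11)]).
Proof.
split=> [T e sg T3 noK|n n5 nmod].
  have -> : num_cliques e = #|cliques_in e setT|.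
    by apply: eq_card => A; rewrite !inE subsetT.
  have noKT : ~ K33_in e setT by move=> [B [_ n0 dB cB eB]]; apply: noK; exists B.
  have := cliques_bound sg noKT; rewrite cardsT; move: T3; clear; lia.
have defn : n = (n %/ 3) * 3 + 2 by rewrite {1}(divn_eq n 3) nmod.
have k0 : 0 < n %/ 3 by lia.
exists (@book n); split; [exact: book_simple | |].
  by rewrite defn; apply: book_K33_free.
(* With [k = n %/ 3], both sides equal [84 * k + 12]. *)
by rewrite defn num_cliques_book; lia.
Qed.
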